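(* Let $k$ be a field and let $P=\{(0,0),(1,0),(0,1),(1,1)\}$ be the square poset with the product order. Let $M$ be the trivial module over $P$, i.e. the $P$-persistence module with $M_v=k$ for every $v\in P$ and with the structure map $M_p\to M_q$ equal to zero for all $p<q$. Then $\mathrm{Ext}^1(M,M)\cong k^4$.
   Context: For a poset $P$, viewed as a small category with a unique morphism $p\to q$ whenever $p\le q$, a $P$-persistence module is a (covariant) functor $M:P\to\mathbf{Vec}_k$ to the category of $k$-vector spaces. For finite $P$, finite-dimensional $P$-persistence modules are identified with finite-dimensional modules over the incidence algebra $A=kP$, and $\mathrm{Ext}^i=\mathrm{Ext}^i_A$ is computed in this abelian category (equivalently, in the functor category). For the square poset, the covering relations are $f_x:(0,0)\to(1,0)$, $f_y:(0,0)\to(0,1)$, $g_y:(1,0)\to(1,1)$, $g_x:(0,1)\to(1,1)$, so a persistence module is a representation of this quiver subject to the commutativity relation $g_y\circ f_x=g_x\circ f_y$. *)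

(* Defs.v *)
From HB Require Import structures.
From mathcomp Require Import all_boot all_order all_algebra.
From mathcomp Require Import boolp.
From mathcomp.multinomials Require Import freeg.

Set Implicit Arguments.
Unset Strict Implicit.
Unset Printing Implicit Defensive.

Import Order.TTheory GRing.Theory.
Local Open Scope ring_scope.
Local Open Scope quotient_scope.

Section Kernel.
Variables (k : fieldType) (V W : lmodType k) (f : {linear V -> W}).

Definition kerp : {pred V} := fun x => f x == 0.

Fact kerp_submod : submod_closed kerp.
Proof.
split; first by rewrite unfold_in linear0.
by move=> a x y; rewrite !unfold_in linearP => /eqP-> /eqP->;
  rewrite scaler0 addr0.
Qed.
HB.instance Definition _ := GRing.isSubmodClosed.Build k V kerp kerp_submod.

Record ker : Type := Ker { ker_val :> V; ker_valP : ker_val \in kerp }.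
HB.instance Definition _ := [isSub for ker_val].
HB.instance Definition _ := [Choice of ker by <:].
HB.instance Definition _ := [SubChoice_isSubLmodule of ker by <:].

Lemma ker_eq0 (x : ker) : f (ker_val x) = 0.
Proof. exact/eqP/ker_valP. Qed.

End Kernel.

Section LinearQuotient.
Variables (k : fieldType) (V : lmodType k) (S : {pred V})
  (Sclosed : submod_closed S).

Definition lquot_pred of submod_closed S : {pred V} := S.
HB.instance Definition _ :=
  GRing.isSubmodClosed.Build k V (lquot_pred Sclosed) Sclosed.

Definition lquot : Type := Quotient.quot (lquot_pred Sclosed).
HB.instance Definition _ := GRing.Zmodule.on lquot.

Definition lquot_pi (x : V) : lquot :=
  \pi_(Quotient.quot (lquot_pred Sclosed)) x.
Definition lquot_repr (u : lquot) : V :=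
  repr (u : Quotient.quot (lquot_pred Sclosed)).

Lemma lquot_reprK u : lquot_pi (lquot_repr u) = u.
Proof. exact: reprK. Qed.

Lemma lquot_piE x y : lquot_pi x = lquot_pi y <-> x - y \in S.
Proof.
have -> : (x - y \in S) = (lquot_pi x == lquot_pi y).
  exact: (Quotient.idealrBE (lquot_pred Sclosed) x y).
by split=> [->|/eqP].
Qed.

Lemma lquot_piD x y : lquot_pi (x + y) = lquot_pi x + lquot_pi y.
Proof. exact: Quotient.pi_add. Qed.

Definition lquot_scale (a : k) (u : lquot) : lquot :=
  lquot_pi (a *: lquot_repr u).

Lemma lquot_piZ a x : lquot_pi (a *: x) = lquot_scale a (lquot_pi x).
Proof.
apply/lquot_piE; rewrite -scalerBr.
have /lquot_piE xS := esym (lquot_reprK (lquot_pi x)).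
by rewrite -[_ *: _]addr0; apply: Sclosed.2 => //; apply: Sclosed.1.
Qed.

Fact lquot_scaleA a b u :
  lquot_scale a (lquot_scale b u) = lquot_scale (a * b) u.
Proof. by rewrite -(lquot_reprK u) -!lquot_piZ scalerA. Qed.
Fact lquot_scale1 : left_id 1 lquot_scale.
Proof. by move=> u; rewrite -(lquot_reprK u) -lquot_piZ scale1r. Qed.
Fact lquot_scaleDr : right_distributive lquot_scale +%R.
Proof.
move=> a u v; rewrite -(lquot_reprK u) -(lquot_reprK v).
by rewrite -lquot_piD -!lquot_piZ -lquot_piD scalerDr.
Qed.
Fact lquot_scaleDl u : {morph lquot_scale^~ u : a b / a + b}.
Proof.
by move=> a b; rewrite -(lquot_reprK u) -!lquot_piZ -lquot_piD scalerDl.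
Qed.
HB.instance Definition _ := GRing.Zmodule_isLmodule.Build k lquot
  lquot_scaleA lquot_scale1 lquot_scaleDr lquot_scaleDl.

Fact lquot_pi_linear : linear lquot_pi.
Proof. by move=> a x y; rewrite lquot_piD lquot_piZ. Qed.
HB.instance Definition _ :=
  GRing.isLinear.Build k V lquot *:%R lquot_pi lquot_pi_linear.

End LinearQuotient.

Section FreeLift.
Variables (k : fieldType) (K : choiceType).

Section Lift.
Variables (V : lmodType k) (g : K -> V).

Fact fglift_add : {morph fglift g : x y / x + y}.
Proof.
have sub x y : fglift g (x - y) = fglift g x - fglift g y.
  exact: lift_is_additive.
have f0 : fglift g 0 = 0 by rewrite -(subrr 0) sub subrr.
move=> x y; rewrite -{1}(opprK y) sub; congr (_ + _).
by rewrite -(add0r (- y)) sub f0 sub0r opprK.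
Qed.

Lemma fgliftU x : fglift g << x >> = g x.
Proof. by rewrite liftU scale1r. Qed.

Fact fglift_sum I (r : seq I) (F : I -> {freeg K / k}) :
  fglift g (\sum_(i <- r) F i) = \sum_(i <- r) fglift g (F i).
Proof.
apply: (big_morph _ fglift_add).
by apply: (@addIr _ (fglift g 0)); rewrite -fglift_add !add0r.
Qed.

Fact fglift_linear : linear (fglift g : {freeg K / k} -> V).
Proof.
move=> a x y; rewrite fglift_add; congr (_ + _).
rewrite -{2}(freeg_sumE x) [a *: x]/(fgscale a x) /fgscale !fglift_sum.
by rewrite scaler_sumr; apply: eq_bigr => i _; rewrite !liftU scalerA.
Qed.
HB.instance Definition _ :=
  GRing.isLinear.Build k {freeg K / k} V *:%R (fglift g) fglift_linear.

End Lift.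

Lemma freeg_linear_ext (V : lmodType k) (f h : {linear {freeg K / k} -> V}) :
  (forall x, f << x >> = h << x >>) -> f =1 h.
Proof.
move=> e D; rewrite -(freeg_sumE D) !linear_sum; apply: eq_bigr => i _.
suff -> : << coeff i D *g i >> = coeff i D *: << i >> by rewrite !linearZ e.
by apply/eqP/freeg_eqP => y; rewrite coeffZ !coeffU mul1r.
Qed.

End FreeLift.

Section PersistenceModules.
Variables (k : fieldType) (disp : Order.disp_t) (P : porderType disp).

Record persmod := PersMod {
  obj :> P -> lmodType k;
  smap : forall p q : P, (p <= q)%O -> {linear obj p -> obj q};
  smap_id : forall (p : P) (pp : (p <= p)%O) x, smap pp x = x;
  smap_comp : forall (p q r : P) (pq : (p <= q)%O) (qr : (q <= r)%O)
    (pr : (p <= r)%O) x, smap pr x = smap qr (smap pq x) }.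

Record pershom (M N : persmod) := PersHom {
  hcomp :> forall p, M p -> N p;
  hcomp_linear : forall p, linear (@hcomp p);
  hcomp_nat : forall p q (pq : (p <= q)%O) x,
    hcomp (smap M pq x) = smap N pq (hcomp x) }.

HB.instance Definition _ M N (f : pershom M N) p :=
  GRing.isLinear.Build k (M p) (N p) *:%R (@hcomp M N f p)
    (@hcomp_linear M N f p).

Lemma pershom_ext M N (f g : pershom M N) :
  (forall p (x : M p), f p x = g p x) -> f = g.
Proof.
case: f g => [f fl fn] [g gl gn] /= e.
have {}e : f = g by apply: functional_extensionality_dep => p; exact: funext.
by move: fl fn; rewrite e => fl fn; congr PersHom; exact: Prop_irrelevance.
Qed.

Section HomSpace.
Variables M N : persmod.
Implicit Types f g h : pershom M N.

HB.instance Definition _ := gen_eqMixin (pershom M N).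
HB.instance Definition _ := gen_choiceMixin (pershom M N).

Program Definition hom0 : pershom M N := @PersHom M N (fun p x => 0) _ _.
Next Obligation. by move=> a x y; rewrite scaler0 addr0. Qed.
Next Obligation. by rewrite linear0. Qed.

Program Definition hom_opp f : pershom M N :=
  @PersHom M N (fun p x => - f p x) _ _.
Next Obligation. by move=> a x y; rewrite linearP opprD scalerN. Qed.
Next Obligation. by rewrite hcomp_nat linearN. Qed.

Program Definition hom_add f g : pershom M N :=
  @PersHom M N (fun p x => f p x + g p x) _ _.
Next Obligation. by move=> a x y; rewrite !linearP scalerDr addrACA. Qed.
Next Obligation. by rewrite !hcomp_nat linearD. Qed.

Program Definition hom_scale a f : pershom M N :=
  @PersHom M N (fun p x => a *: f p x) _ _.
Next Obligation.
by move=> b x y; rewrite linearP scalerDr !scalerA [a * b]mulrC.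
Qed.
Next Obligation. by rewrite hcomp_nat linearZ. Qed.

Fact hom_addA : associative hom_add.
Proof. by move=> f g h; apply: pershom_ext => p x /=; rewrite addrA. Qed.
Fact hom_addC : commutative hom_add.
Proof. by move=> f g; apply: pershom_ext => p x /=; rewrite addrC. Qed.
Fact hom_add0 : left_id hom0 hom_add.
Proof. by move=> f; apply: pershom_ext => p x /=; rewrite add0r. Qed.
Fact hom_addN : left_inverse hom0 hom_opp hom_add.
Proof. by move=> f; apply: pershom_ext => p x /=; rewrite addNr. Qed.
HB.instance Definition _ := GRing.isZmodule.Build (pershom M N)
  hom_addA hom_addC hom_add0 hom_addN.

Fact hom_scaleA a b f : hom_scale a (hom_scale b f) = hom_scale (a * b) f.
Proof. by apply: pershom_ext => p x /=; rewrite scalerA. Qed.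
Fact hom_scale1 : left_id 1 hom_scale.
Proof. by move=> f; apply: pershom_ext => p x /=; rewrite scale1r. Qed.
Fact hom_scaleDr : right_distributive hom_scale +%R.
Proof. by move=> a f g; apply: pershom_ext => p x /=; rewrite scalerDr. Qed.
Fact hom_scaleDl f : {morph hom_scale^~ f : a b / a + b}.
Proof. by move=> a b; apply: pershom_ext => p x /=; rewrite scalerDl. Qed.
HB.instance Definition _ := GRing.Zmodule_isLmodule.Build k (pershom M N)
  hom_scaleA hom_scale1 hom_scaleDr hom_scaleDl.

End HomSpace.

Program Definition pcomp (L M N : persmod) (g : pershom M N) (f : pershom L M)
  : pershom L N := @PersHom L N (fun p x => g p (f p x)) _ _.
Next Obligation. by move=> a x y; rewrite !linearP. Qed.
Next Obligation. by rewrite !hcomp_nat. Qed.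

(* Kernels and cokernels of functors are computed pointwise, so epimorphisms
   are the pointwise surjections and exactness is pointwise exactness. *)
Definition epi (M N : persmod) (f : pershom M N) : Prop :=
  forall p (y : N p), exists x, f p x = y.

Definition exact_at (L M N : persmod) (f : pershom L M) (g : pershom M N) : Prop :=
  forall p (y : M p), g p y = 0 <-> exists x, f p x = y.

Definition projective (Q : persmod) : Prop :=
  forall (M N : persmod) (e : pershom M N) (f : pershom Q N),
    epi e -> exists g : pershom Q M, pcomp e g = f.

Record proj_resolution (M : persmod) := ProjResolution {
  res_obj :> nat -> persmod;
  res_d : forall n, pershom (res_obj n.+1) (res_obj n);
  res_aug : pershom (res_obj 0) M;
  res_proj : forall n, projective (res_obj n);
  res_epi : epi res_aug;
  res_exact0 : exact_at (res_d 0) res_aug;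
  res_exactS : forall n, exact_at (res_d n.+1) (res_d n) }.

Section Cohomology.
Variables (M N : persmod) (R : proj_resolution M).

Definition cochain n : lmodType k := pershom (R n) N.

(* No sign (-1)^n: it changes neither cocycles nor coboundaries. *)
Definition cobd n (f : cochain n) : cochain n.+1 := pcomp f (res_d R n).

Fact cobd_linear n : linear (@cobd n).
Proof. by move=> a f g; apply: pershom_ext. Qed.
HB.instance Definition _ n := GRing.isLinear.Build k (cochain n)
  (cochain n.+1) *:%R (@cobd n) (@cobd_linear n).

Definition cocycle n : lmodType k := ker (@cobd n).

Definition is_coboundary n : cochain n -> Prop :=
  match n with
  | 0 => fun f => f = 0
  | m.+1 => fun f => exists g : cochain m, f = cobd g
  end.

Definition coboundary n : {pred cocycle n} :=
  fun z => `[< is_coboundary (ker_val z) >].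

Fact coboundary_submod n : submod_closed (@coboundary n).
Proof.
split=> [|a x y /asboolP + /asboolP +]; last first.
  move=> ex ey; apply/asboolP; move: x y ex ey; case: n => [|n] x y /=.
    by move=> -> ->; rewrite scaler0 addr0.
  by move=> [f ->] [g ->]; exists (a *: f + g); rewrite linearP.
by apply/asboolP; case: n => //= n; exists 0; rewrite linear0.
Qed.

Definition hom_cohomology n : lmodType k := lquot (@coboundary_submod n).

End Cohomology.

(* The free module on the elements of X: the direct sum, over all p and all
   x in X p, of the representable module of p. *)
Section FreeCover.
Variable X : persmod.

Definition fbasis (q : P) : choiceType :=
  {s : {p : P | (p <= q)%O} & X (sval s)}.

Definition fgen p q (pq : (p <= q)%O) (x : X p) : fbasis q :=
  existT _ (exist _ p pq) x.

Definition fpush p q (pq : (p <= q)%O) (s : fbasis p) : fbasis q :=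
  fgen (le_trans (proj2_sig (tag s)) pq) (tagged s).

Lemma fpush_gen r p q (rp : (r <= p)%O) (pq : (p <= q)%O) (rq : (r <= q)%O)
  (x : X r) : fpush pq (fgen rp x) = fgen rq x.
Proof. by rewrite /fpush /= (bool_irrelevance (le_trans _ _) rq). Qed.

Definition free_map p q (pq : (p <= q)%O) :
    {linear {freeg (fbasis p) / k} -> {freeg (fbasis q) / k}} :=
  fglift (fun s => << fpush pq s >>).

Lemma free_mapU p q (pq : (p <= q)%O) s :
  free_map pq << s >> = << fpush pq s >>.
Proof. exact: fgliftU. Qed.

Fact free_map_id p (pp : (p <= p)%O) x : free_map pp x = x.
Proof.
apply: (@freeg_linear_ext _ _ _ (free_map pp) idfun) => -[[r rp] y].
by rewrite free_mapU (fpush_gen rp pp rp).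
Qed.

Fact free_map_comp (p q r : P) (pq : (p <= q)%O) (qr : (q <= r)%O)
  (pr : (p <= r)%O) x : free_map pr x = free_map qr (free_map pq x).
Proof.
apply: (@freeg_linear_ext _ _ _ (free_map pr) (free_map qr \o free_map pq)).
move=> [[t tp] y] /=; have tq := le_trans tp pq; have tr := le_trans tq qr.
by rewrite !free_mapU (fpush_gen tp pr tr) (fpush_gen tp pq tq)
  (fpush_gen tq qr tr).
Qed.

Definition free_cover : persmod := PersMod free_map_id free_map_comp.

Section FreeExtend.
Variables (M : persmod) (g : forall p, X p -> M p).

Definition free_ext p : free_cover p -> M p :=
  fglift (fun s : fbasis p => smap M (proj2_sig (tag s)) (g (tagged s)) : M p).

Lemma free_extU r p (rp : (r <= p)%O) x :
  free_ext << fgen rp x >> = smap M rp (g x).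
Proof. by rewrite /free_ext fgliftU. Qed.

Fact free_ext_linear p : linear (@free_ext p).
Proof. exact: (@fglift_linear _ _ (M p)). Qed.
HB.instance Definition _ p := GRing.isLinear.Build k (free_cover p) (M p) *:%R
  (@free_ext p) (@free_ext_linear p).

Fact free_ext_nat p q (pq : (p <= q)%O) x :
  free_ext (smap free_cover pq x) = smap M pq (free_ext x).
Proof.
apply: (@freeg_linear_ext _ _ _ (@free_ext q \o free_map pq)
  (smap M pq \o @free_ext p)) => -[[t tp] y] /=.
have tq := le_trans tp pq.
by rewrite free_mapU (fpush_gen tp pq tq) !free_extU (smap_comp tp pq tq).
Qed.

Definition free_lift : pershom free_cover M :=
  PersHom free_ext_linear free_ext_nat.

End FreeExtend.

Lemma free_cover_projective : projective free_cover.
Proof.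
move=> M N e f eepi.
pose g p (x : X p) : M p :=
  projT1 (cid (eepi p (f p << fgen (lexx p) x >>))).
have eg p x : e p (g p x) = f p << fgen (lexx p) x >>.
  by rewrite /g; case: cid.
exists (free_lift g); apply: pershom_ext => q.
pose eg' : {linear {freeg (fbasis q) / k} -> N q} := e q \o @free_ext _ g q.
pose fq : {linear {freeg (fbasis q) / k} -> N q} :=
  (f q : {linear free_cover q -> N q}).
move=> x; suff /(_ x) : eg' =1 fq by [].
apply: freeg_linear_ext => -[[p pq] y]; rewrite /eg' /fq /=.
by rewrite free_extU hcomp_nat eg -hcomp_nat free_mapU (fpush_gen _ _ pq).
Qed.

Definition free_aug : pershom free_cover X := free_lift (fun _ => id).

Lemma free_aug_epi : epi free_aug.
Proof.
move=> p y; exists << fgen (lexx p) y >>.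
by rewrite /= free_extU smap_id.
Qed.

End FreeCover.

Section KernelModule.
Variables (M N : persmod) (f : pershom M N).

Fact pker_proof p q (pq : (p <= q)%O) (x : ker (f p)) :
  smap M pq (ker_val x) \in kerp (f q).
Proof. by rewrite unfold_in /= hcomp_nat ker_eq0 linear0. Qed.

Definition pker_map p q (pq : (p <= q)%O) (x : ker (f p)) : ker (f q) :=
  Ker (pker_proof pq x).

Fact pker_map_linear p q (pq : (p <= q)%O) : linear (pker_map pq).
Proof. by move=> a x y; apply: val_inj; rewrite /= linearP. Qed.
HB.instance Definition _ p q (pq : (p <= q)%O) := GRing.isLinear.Build k
  (ker (f p)) (ker (f q)) *:%R (pker_map pq) (pker_map_linear pq).

Program Definition pker : persmod :=
  @PersMod (fun p => ker (f p)) (fun p q pq => pker_map pq) _ _.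
Next Obligation. by apply: val_inj; rewrite /= smap_id. Qed.
Next Obligation. by apply: val_inj; rewrite /= (smap_comp pq qr pr). Qed.

Program Definition pker_incl : pershom pker M :=
  @PersHom pker M (fun p x => ker_val x) _ _.
Next Obligation. by []. Qed.

End KernelModule.

Section FreeResolution.
Variable M : persmod.

Definition syzygy n : persmod := iter n (fun X => pker (free_aug X)) M.

Definition free_res n : persmod := free_cover (syzygy n).

Definition free_d n : pershom (free_res n.+1) (free_res n) :=
  pcomp (pker_incl (free_aug (syzygy n))) (free_aug (syzygy n.+1)).

Fact free_exact (n : nat) : exact_at (free_d n) (free_aug (syzygy n)).
Proof.
move=> p y; split=> [y0|[x <-]]; last exact: ker_eq0.
have yK : y \in kerp (free_aug (syzygy n) p) by apply/eqP.
by have [x xy] := free_aug_epi (Ker yK : syzygy n.+1 p); exists x;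
  exact: (congr1 (@ker_val _ _ _ _) xy).
Qed.

Fact free_exactS (n : nat) : exact_at (free_d n.+1) (free_d n).
Proof.
move=> p y; rewrite -(@free_exact n.+1 p y) /=; split=> [y0|->] //.
exact: val_inj.
Qed.

Definition free_resolution : proj_resolution M :=
  @ProjResolution M free_res free_d (free_aug M)
    (fun n => @free_cover_projective (syzygy n)) (@free_aug_epi M)
    (@free_exact 0) free_exactS.

End FreeResolution.

(* The n-th right derived functor of Hom(-, N), on the resolution of M by
   free modules; kernels of the successive free covers are the syzygies. *)
Definition Ext (n : nat) (M N : persmod) : lmodType k :=
  hom_cohomology N (free_resolution M) n.

Section TrivialModule.

(* The identity when p = q, as functoriality forces; zero when p < q. *)
Definition trivial_map (p q : P) : k^o -> k^o :=
  fun x => if p == q then x else 0.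

Fact trivial_map_linear p q : linear (trivial_map p q).
Proof.
by move=> a x y; rewrite /trivial_map; case: ifP => //; rewrite scaler0 addr0.
Qed.
HB.instance Definition _ p q := GRing.isLinear.Build k k^o k^o *:%R
  (trivial_map p q) (trivial_map_linear p q).

Program Definition trivial_mod : persmod :=
  @PersMod (fun _ => k^o) (fun p q _ => trivial_map p q) _ _.
Next Obligation. by rewrite /trivial_map eqxx. Qed.
Next Obligation.
rewrite /trivial_map; case: (eqVneq p r) => [epr|npr].
  have <- : p = q by apply/le_anti; rewrite pq epr qr.
  by rewrite epr !eqxx.
case: (eqVneq q r) => [eqr|//]; case: (eqVneq p q) => [epq|//].
by rewrite epq eqr eqxx in npr.
Qed.

End TrivialModule.

End PersistenceModules.

(* 'I_2 *p 'I_2 carries the componentwise (product) order. *)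
Definition square : porderType _ := ('I_2 *p 'I_2)%type.

(* Main.v *)
From HB Require Import structures.
From mathcomp Require Import all_boot all_order all_algebra.
From mathcomp Require Import boolp.
From mathcomp.multinomials Require Import freeg.
Require Import Defs.

(** Let [K] be the kernel of the free cover [F] of [N]: then
    [Ext 1 N M = Hom(K, M) / Hom(F, M)].  For [N = M] trivial over any poset, a
    morphism [K -> M] is evaluated at the elements [<<p <= q, 1>>] of [K q], one
    for each covering pair [p < q].  Morphisms extending to [F] vanish there by
    naturality; a morphism vanishing there extends to [F], because [M] kills
    whatever comes from [K r] with [r < q], which includes [<<p <= q, 1>>] as
    soon as [p < r < q].  Any weights [w] on covering pairs are attained, by
    [<<p <= q, x>> |-> w p q * x] restricted to [K]: after pushing an element of
    [K q] to [r > q], only the terms [p = q] contribute, by [w q r] times the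
    augmentation, which is zero.  So [Ext 1 M M] has one dimension per covering
    pair. *)

Set Implicit Arguments.
Unset Strict Implicit.
Unset Printing Implicit Defensive.

Import Order.TTheory GRing.Theory.
Local Open Scope ring_scope.

(** * Linear quotients *)

(** First isomorphism theorem; the inverse sends [w] to the class of a chosen preimage. *)
Lemma lquot_iso (k : fieldType) (V W : lmodType k) (S : {pred V})
    (S_closed : submod_closed S) (f : {linear V -> W}) :
    (forall x, (x \in S) = (f x == 0)) -> (forall w, exists x, f x = w) ->
  exists g : {linear lquot S_closed -> W}, bijective g.
Proof.
move=> kerf surjf.
pose g (u : lquot S_closed) := f (lquot_repr u).
have gpi x : g (lquot_pi S_closed x) = f x.
  have /lquot_piE := lquot_reprK (lquot_pi S_closed x).
  by rewrite kerf linearB subr_eq0 => /eqP.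
have g_linear : linear g.
  move=> a u v; rewrite -(lquot_reprK u) -(lquot_reprK v) -linearP !gpi.
  by rewrite linearP.
pose gL := GRing.isLinear.Build k (lquot S_closed) W *:%R g g_linear.
pose g' : {linear lquot S_closed -> W} := HB.pack g gL.
exists g'.
pose h w := lquot_pi S_closed (projT1 (cid (surjf w))).
exists h => [u|w]; rewrite /h; case: cid => x /= fx; last by rewrite [LHS]gpi.
rewrite -[u in RHS]lquot_reprK; apply/lquot_piE.
by rewrite kerf linearB fx subrr.
Qed.

Section ExtOne.
Variables (k : fieldType) (disp : Order.disp_t) (P : porderType disp).

(* The generic [linearB] etc. leave [hcomp] behind a [GRing.Linear.sort]. *)
Lemma hcompD (A B : persmod k P) (f : pershom A B) p x y :
  f p (x + y) = f p x + f p y.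
Proof. exact: linearD. Qed.

Lemma hcompB (A B : persmod k P) (f : pershom A B) p x y :
  f p (x - y) = f p x - f p y.
Proof. exact: linearB. Qed.

Lemma hcompZ (A B : persmod k P) (f : pershom A B) p a x :
  f p (a *: x) = a *: f p x.
Proof. exact: linearZ. Qed.

(** Two preimages of a point under [e] differ by an element that [f] kills, so [f] of any chosen
    preimage is well defined, and linearity and naturality descend from [f]. *)
Lemma pershom_factor (A B N : persmod k P) (e : pershom A B) (f : pershom A N) :
    epi e -> (forall p (x : A p), e p x = 0 -> f p x = 0) ->
  exists phi : pershom B N, pcomp phi e = f.
Proof.
move=> e_epi kerf.
pose s p (y : B p) := projT1 (cid (e_epi p y)).
have es p (y : B p) : e p (s p y) = y by rewrite /s; case: cid.
pose phi p (y : B p) := f p (s p y).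
have phiE p x : phi p (e p x) = f p x.
  by apply/eqP; rewrite -subr_eq0 -hcompB kerf // hcompB es subrr.
have phi_linear p : linear (@phi p).
  move=> a x y; rewrite -{1}(es p x) -{1}(es p y) -hcompZ -hcompD phiE.
  by rewrite hcompD hcompZ.
have phi_nat p q (pq : (p <= q)%O) x :
    phi q (smap B pq x) = smap N pq (phi p x).
  by rewrite -(es p x) -hcomp_nat !phiE hcomp_nat.
by exists (PersHom phi_linear phi_nat); apply: pershom_ext.
Qed.

Definition covers (p q : P) : Prop :=
  (p < q)%O /\ forall r, (p < r)%O -> ~~ (r < q)%O.

(** * Generators of the free cover and of its kernel *)

Let M := trivial_mod k P.
Let F := free_cover M.
Let K := pker (free_aug M).

Lemma trivial_smap0 p q (pq : (p <= q)%O) (x : M p) :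
  p != q -> smap M pq x = 0.
Proof. by move=> /negPf npq; rewrite /= /trivial_map npq. Qed.

Definition gen p q (pq : (p <= q)%O) (x : k) : F q := << fgen pq (x : M p) >>.

Lemma gen_smap p q r (pq : (p <= q)%O) (qr : (q <= r)%O) (pr : (p <= r)%O) x :
  smap F qr (gen pq x) = gen pr x.
Proof. by rewrite [LHS]free_mapU (fpush_gen pq qr pr). Qed.

Lemma aug_gen p q (pq : (p <= q)%O) x :
  free_aug M q (gen pq x) = if p == q then x else 0.
Proof. exact: free_extU. Qed.

(* A linear retraction of [F q] onto [K q], which is not natural in [q]. *)
Definition retract_val q (D : F q) : F q :=
  D - (free_aug M q D : k) *: gen (lexx q) 1.

Lemma retract_proof q (D : F q) : retract_val D \in kerp (free_aug M q).
Proof.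
apply/eqP; rewrite [LHS]hcompB hcompZ aug_gen eqxx.
by rewrite [_ *: _]mulr1 subrr.
Qed.

Definition retract q (D : F q) : K q := Ker (retract_proof D).

Lemma retract_linear q : linear (@retract q).
Proof.
move=> a x y; apply: val_inj; rewrite /= /retract_val linearP.
by rewrite scalerDl scalerBr -scalerA opprD addrACA.
Qed.

HB.instance Definition _ q :=
  GRing.isLinear.Build k (F q) (K q) *:%R (@retract q) (@retract_linear q).

Lemma retract_ker q (x : K q) : retract (ker_val x) = x.
Proof. by apply: val_inj; rewrite /= /retract_val ker_eq0 scale0r subr0. Qed.

Lemma retract_val_gen p q (pq : (p <= q)%O) x :
  p != q -> retract_val (gen pq x) = gen pq x.
Proof. by move=> /negPf npq; rewrite /retract_val aug_gen npq scale0r subr0. Qed.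

Lemma hom_retract_eq0 (phi : pershom K M) :
    (forall p q (pq : (p <= q)%O), covers p q ->
       phi q (retract (gen pq 1)) = 0) ->
  forall p q (pq : (p <= q)%O) x, p != q -> phi q (retract (gen pq x)) = 0.
Proof.
move=> phi0 p q pq x npq.
have phi1 : phi q (retract (gen pq 1)) = 0.
  have [/phi0 //|ncov] := pselect (covers p q).
  have [r pr rq] : exists2 r, (p < r)%O & (r < q)%O.
    apply: contrapT => nr; apply: ncov; split; first by rewrite lt_neqAle npq.
    by move=> r pr; apply/negP => rq; apply: nr; exists r.
  have -> : retract (gen pq 1) = smap K (ltW rq) (retract (gen (ltW pr) 1)).
    apply: val_inj; rewrite [LHS]retract_val_gen //.
    rewrite [RHS](_ : _ = smap F (ltW rq) (retract_val (gen (ltW pr) 1))) //.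
    by rewrite retract_val_gen ?(lt_eqF pr) // (gen_smap _ _ pq).
  by rewrite hcomp_nat trivial_smap0 // lt_eqF.
(* The generator is not linear in [x]. The defect [gen (lexx p) x - x *: gen (lexx p) 1] lies in
   [K p], and [phi] kills its push to [q] by naturality, which leaves only [x = 1]. *)
have -> : retract (gen pq x) =
    smap K pq (retract (gen (lexx p) x)) + x *: retract (gen pq 1).
  apply: val_inj; rewrite [LHS]retract_val_gen //.
  rewrite [RHS](_ : _ = smap F pq (retract_val (gen (lexx p) x)) +
    x *: retract_val (gen pq 1)) // (retract_val_gen pq) // /retract_val.
  by rewrite aug_gen eqxx linearB linearZ !(gen_smap _ _ pq) subrK.
by rewrite hcompD hcompZ phi1 scaler0 addr0 hcomp_nat trivial_smap0.
Qed.

Lemma hom_extends (phi : pershom K M) :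
    (forall p q (pq : (p <= q)%O), covers p q ->
       phi q (retract (gen pq 1)) = 0) ->
  exists g : pershom F M, forall q (x : K q), g q (ker_val x) = phi q x.
Proof.
move=> /hom_retract_eq0 phi0.
(* On a generator born at [p], [g] must agree with [phi] at [p] itself; the choice made here sends
   [gen (lexx p) 1], whose retraction is zero, to 0. *)
pose g := @free_lift _ _ _ M M (fun p x => phi p (retract (gen (lexx p) x))).
exists g => q x; rewrite -[in RHS](retract_ker x).
pose h : {linear {freeg (fbasis M q) / k} -> M q} := phi q \o @retract q.
pose gq : {linear {freeg (fbasis M q) / k} -> M q} :=
  (g q : {linear F q -> M q}).
suff /(_ (ker_val x)) : gq =1 h by [].
apply: freeg_linear_ext => -[[p pq] y]; rewrite /gq /h /=.
rewrite [LHS](free_extU _ pq); have [epq|npq] := eqVneq p q; last first.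
  by rewrite trivial_smap0 // phi0.
case: q / epq x h gq pq y => x h gq pq y; rewrite smap_id.
by rewrite (bool_irrelevance (lexx p) pq).
Qed.

(** * Morphisms with prescribed values on covering pairs *)

Section Weights.
Variables (w : P -> P -> k) (wcov : forall p q, ~ covers p q -> w p q = 0).

Definition weight_val q : F q -> k^o :=
  fglift (fun s : fbasis M q =>
    w (sval (tag s)) q * (tagged s : k) : k^o).

Lemma weight_valU p q (pq : (p <= q)%O) x : weight_val (gen pq x) = w p q * x.
Proof. exact: (@fgliftU _ _ k^o). Qed.

Lemma weight_val_linear q : linear (@weight_val q).
Proof. exact: (@fglift_linear _ _ k^o). Qed.

HB.instance Definition _ q := GRing.isLinear.Build k (F q) k^o *:%R
  (@weight_val q) (@weight_val_linear q).

(** Checked on a generator [gen pq y]: for [p = q] both sides are [w q r * y]; for [p < q < r] the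
    pair [(p, r)] is not covering, so its weight vanishes, as does the augmentation. *)
Lemma weight_val_smap q r (qr : (q <= r)%O) (D : F q) :
  q != r -> weight_val (smap F qr D) = w q r * (free_aug M q D : k).
Proof.
move=> nqr.
pose f1 : {linear {freeg (fbasis M q) / k} -> k^o} :=
  @weight_val r \o free_map M qr.
pose f2 : {linear {freeg (fbasis M q) / k} -> k^o} :=
  w q r \*: (free_aug M q : {linear F q -> k^o}).
suff /(_ D) : f1 =1 f2 by [].
apply: freeg_linear_ext => -[[p pq] y].
have pr := le_trans pq qr.
rewrite [LHS](_ : _ = weight_val (smap F qr (gen pq y))) //.
rewrite (gen_smap _ _ pr) weight_valU.
rewrite [RHS](_ : _ = w q r * (free_aug M q (gen pq y))) // aug_gen.
have [->//|npq] := eqVneq p q; rewrite mulr0 wcov ?mul0r // => -[_ /(_ q)].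
by rewrite !lt_neqAle npq pq nqr qr => /(_ isT).
Qed.

Definition weight_fun q (x : K q) : M q := weight_val (ker_val x).

Lemma weight_linear q : linear (@weight_fun q).
Proof. by move=> a x y; rewrite /weight_fun /= linearP. Qed.

Lemma weight_nat p q (pq : (p <= q)%O) x :
  weight_fun (smap K pq x) = smap M pq (weight_fun x).
Proof.
have [epq|npq] := eqVneq p q.
  by case: q / epq pq => pq; rewrite !smap_id.
by rewrite trivial_smap0 // /weight_fun [LHS]weight_val_smap // ker_eq0 mulr0.
Qed.

Definition weight_hom : pershom K M := PersHom weight_linear weight_nat.

End Weights.

(** * Cocycles and coboundaries in degree one *)

(** Cocycles live on the free cover of [K], so evaluating them at an element of [K q] requires a
    lift of it. *)
Definition elift p q (pq : (p <= q)%O) : free_cover K q :=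
  << fgen (lexx q) (retract (gen pq 1)) >>.

Lemma aug_elift p q (pq : (p <= q)%O) :
  free_aug K q (elift pq) = retract (gen pq 1).
Proof. by rewrite [LHS]free_extU smap_id. Qed.

Let cocycles := cocycle M (free_resolution M) 1.

(** A cocycle vanishes on the image of the next differential, which by exactness is the kernel of
    [free_aug K]. *)
Lemma cocycle_factor (z : cocycles) :
  exists phi : pershom K M, pcomp phi (free_aug K) = ker_val z.
Proof.
apply: pershom_factor; first exact: free_aug_epi.
move=> p x /(@free_exact _ _ _ M 1 p x)[y <-].
exact: (congr1 (fun f : pershom _ _ => f p y) (ker_eq0 z)).
Qed.

Lemma cocycle_of_hom (phi : pershom K M) :
  exists z : cocycles, ker_val z = pcomp phi (free_aug K).
Proof.
have phiK : (pcomp phi (free_aug K) : cochain M (free_resolution M) 1)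
    \in kerp (@cobd _ _ _ M M (free_resolution M) 1).
  rewrite unfold_in; apply/eqP/pershom_ext => p x.
  by rewrite [LHS]/= ker_eq0 linear0.
by exists (Ker phiK).
Qed.

(** The first differential is [free_aug K] followed by the inclusion of [K] in [F]; the epimorphism
    cancels. *)
Lemma coboundaryP (z : cocycles) (phi : pershom K M) :
    pcomp phi (free_aug K) = ker_val z ->
  z \in @coboundary _ _ _ M M (free_resolution M) 1 <->
  exists g : pershom F M, forall q (x : K q), g q (ker_val x) = phi q x.
Proof.
move=> zE; split.
  move=> /asboolP[g zg]; exists g => q x.
  have [y <-] := free_aug_epi x.
  by have /(congr1 (fun f : pershom _ _ => f q y)) := etrans zE zg.
move=> [g gphi]; apply/asboolP; exists g; rewrite -zE.
by apply: pershom_ext => p x; rewrite [RHS]gphi.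
Qed.

Theorem Ext1_trivial n (c : 'I_n -> P * P) :
    injective c -> (forall p q, covers p q <-> exists i, c i = (p, q)) ->
  exists f : {linear Ext 1 M M -> 'rV[k]_n}, bijective f.
Proof.
move=> c_inj ccov.
have ccovi i : covers (c i).1 (c i).2.
  by apply/ccov; exists i; rewrite -surjective_pairing.
have cle i : ((c i).1 <= (c i).2)%O by have [/ltW] := ccovi i.
have cneq i : (c i).1 != (c i).2 by have [/lt_eqF->] := ccovi i.
pose ev (z : cocycles) : 'rV[k]_n :=
  \row_i (ker_val z : pershom (free_cover K) M) (c i).2 (elift (cle i)).
have ev_linear : linear ev by move=> a x y; apply/rowP => i; rewrite !mxE.
pose evL := GRing.isLinear.Build k cocycles 'rV[k]_n *:%R ev ev_linear.
pose ev' : {linear cocycles -> 'rV[k]_n} := HB.pack ev evL.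
apply: (lquot_iso _ (f := ev')) => [z|v].
  have [phi zE] := cocycle_factor z.
  have evE i : ev z 0 i = phi (c i).2 (retract (gen (cle i) 1)).
    by rewrite mxE -zE /= -aug_elift.
  apply/idP/eqP => [/(coboundaryP zE)[g gphi]|ev0].
    apply/rowP => i; rewrite [LHS]evE -gphi [ker_val _]retract_val_gen // mxE.
    rewrite -(gen_smap (lexx _) (cle i) (cle i)) hcomp_nat.
    by rewrite trivial_smap0.
  apply/(coboundaryP zE)/hom_extends => p q pq /ccov[i ci].
  (* The proof [cle i] is generalized because its type mentions [c i], which is about to be
     rewritten. *)
  have := evE i; rewrite -[ev z]/(ev' z) ev0 mxE; move: (cle i); rewrite ci /=.
  by move=> pq'; rewrite (bool_irrelevance pq' pq).
(* By injectivity of [c], the sum at [c i] has the single nonzero candidate [v 0 i]. *)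
pose w p q : k := \sum_i (c i == (p, q))%:R * v 0 i.
have wcov p q : ~ covers p q -> w p q = 0.
  move=> ncov; apply: big1 => i _; case: eqP => [ci|]; last by rewrite mul0r.
  by case: ncov; apply/ccov; exists i.
have [z zE] := cocycle_of_hom (weight_hom wcov).
exists z; apply/rowP => i; rewrite mxE zE.
rewrite [LHS](_ : _ = weight_val w (retract_val (gen (cle i) 1))).
  rewrite retract_val_gen // weight_valU mulr1 /w (bigD1 i) //=.
  rewrite -surjective_pairing eqxx mul1r big1 ?addr0 // => j ji.
  by rewrite (inj_eq c_inj) (negPf ji) mul0r.
by rewrite -[retract_val _]/(ker_val (retract _)) -aug_elift.
Qed.

End ExtOne.

(** * Covering pairs of the square *)

Definition square_edge (i : 'I_4) : square * square :=
  nth ((ord0, ord0), (ord0, ord0))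
    [:: ((ord0, ord0), (ord_max, ord0)); ((ord0, ord0), (ord0, ord_max));
        ((ord_max, ord0), (ord_max, ord_max));
        ((ord0, ord_max), (ord_max, ord_max))] i.

Lemma square_edge_inj : injective square_edge.
Proof.
by move=> [[|[|[|[|i]]]] hi] [[|[|[|[|j]]]] hj] // e; apply: val_inj.
Qed.

Lemma square_coversP (p q : square) :
  covers p q <-> exists i, square_edge i = (p, q).
Proof.
have ord2P (i : 'I_2) : i = ord0 \/ i = ord_max.
  by case: i => [[|[|//]] hi]; [left|right]; apply: val_inj.
split.
  case: p q => [p1 p2] [q1 q2] [].
  case: (ord2P p1) => ->; case: (ord2P p2) => ->;
  case: (ord2P q1) => ->; case: (ord2P q2) => -> //= _ nr.
  (* Five strict pairs remain: the four edges and the diagonal, which [(ord0, ord_max)]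
     interrupts. *)
  - by exists (@Ordinal 4 1 isT).
  - by exists (@Ordinal 4 0 isT).
  - by have := nr (ord0, ord_max) isT.
  - by exists (@Ordinal 4 3 isT).
  - by exists (@Ordinal 4 2 isT).
move=> [[[|[|[|[|//]]]] hi] [<- <-]]; split=> // -[r1 r2];
  by case: (ord2P r1) => ->; case: (ord2P r2) => ->.
Qed.

Theorem proposition5p2 (k : fieldType) :
  exists f : {linear Ext 1 (trivial_mod k square) (trivial_mod k square) -> 'rV[k]_4},
    bijective f.
Proof. exact: (Ext1_trivial k square_edge_inj square_coversP). Qed.
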